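(* Let $\mathcal{X}$ be a finite set with $|\mathcal{X}|\geq 2$. Then no natural topology on $\mathrm{DMC}_{\mathcal{X},\ast}^{(o)}$ is completely metrizable.
   Context: For finite nonempty sets $\mathcal{X},\mathcal{Y}$, $\mathrm{DMC}_{\mathcal{X},\mathcal{Y}}$ is the set of channels from $\mathcal{X}$ to $\mathcal{Y}$, i.e. functions $W:\mathcal{X}\times\mathcal{Y}\to[0,1]$, written $W(y|x)$, with $\sum_{y\in\mathcal{Y}}W(y|x)=1$ for every $x\in\mathcal{X}$. It carries the topology inherited from the Euclidean topology of $\mathbb{R}^{\mathcal{X}\times\mathcal{Y}}$. For $W\in\mathrm{DMC}_{\mathcal{X},\mathcal{Y}}$ and $V\in\mathrm{DMC}_{\mathcal{Y},\mathcal{Z}}$, the composition $V\circ W\in\mathrm{DMC}_{\mathcal{X},\mathcal{Z}}$ is $(V\circ W)(z|x)=\sum_{y\in\mathcal{Y}}V(z|y)W(y|x)$. A channel $W'\in\mathrm{DMC}_{\mathcal{X},\mathcal{Z}}$ is degraded from $W\in\mathrm{DMC}_{\mathcal{X},\mathcal{Y}}$ if $W'=V\circ W$ for some $V\in\mathrm{DMC}_{\mathcal{Y},\mathcal{Z}}$; $W$ and $W'$ are equivalent if each is degraded from the other. $\mathrm{DMC}_{\mathcal{X},\mathcal{Y}}^{(o)}$ is the quotient of $\mathrm{DMC}_{\mathcal{X},\mathcal{Y}}$ by this equivalence relation, with the quotient topology $\mathcal{T}_{\mathcal{X},\mathcal{Y}}^{(o)}$. Let $[n]=\{1,\dots,n\}$,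 let $\mathrm{DMC}_{\mathcal{X},\ast}=\coprod_{n\ge1}\mathrm{DMC}_{\mathcal{X},[n]}$, and let $\mathrm{DMC}_{\mathcal{X},\ast}^{(o)}$ be the quotient set of $\mathrm{DMC}_{\mathcal{X},\ast}$ by equivalence of channels. For each $n\geq 1$, $\mathrm{DMC}_{\mathcal{X},[n]}^{(o)}$ is identified with the subset of $\mathrm{DMC}_{\mathcal{X},\ast}^{(o)}$ consisting of the classes containing a channel with output alphabet $[n]$; these subsets increase with $n$ and their union is $\mathrm{DMC}_{\mathcal{X},\ast}^{(o)}$. A topology on $\mathrm{DMC}_{\mathcal{X},\ast}^{(o)}$ is called natural if for every $n\ge1$ the subspace topology it induces on $\mathrm{DMC}_{\mathcal{X},[n]}^{(o)}$ is $\mathcal{T}_{\mathcal{X},[n]}^{(o)}$. A topology is completely metrizable if it is induced by some complete metric. *)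

(* Defs.v *)
From HB Require Import structures.
From mathcomp Require Import all_boot all_order all_algebra.
From mathcomp Require Import generic_quotient.
From mathcomp Require Import all_classical all_reals all_analysis.

Set Implicit Arguments.
Unset Strict Implicit.
Unset Printing Implicit Defensive.

Import Order.TTheory GRing.Theory Num.Theory.
Import numFieldNormedType.Exports.

Local Open Scope classical_set_scope.
Local Open Scope ring_scope.
Local Open Scope quotient_scope.

Section Channels.
Variable R : realType.

(* [W (x, y)] is the transition probability W(y|x).  As the index set is
   finite, the product topology on [{ptws X * Y -> R}] is the Euclidean one. *)
Definition is_channel (X Y : finType) : set {ptws X * Y -> R} :=
  [set W | (forall x y, 0 <= W (x, y) <= 1) /\
           (forall x, \sum_(y : Y) W (x, y) = 1)].

(* The library topology on a [set_type] is the subspace topology. *)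
Definition channel (X Y : finType) : topologicalType :=
  set_type (@is_channel X Y).

Definition prob (X Y : finType) (W : channel X Y) (x : X) (y : Y) : R :=
  (\val W : X * Y -> R) (x, y).

Lemma prob_bounds (X Y : finType) (W : channel X Y) x y :
  0 <= prob W x y <= 1.
Proof. by have [h _] := set_mem (valP W); exact: h. Qed.

Lemma prob_sum1 (X Y : finType) (W : channel X Y) x :
  \sum_(y : Y) prob W x y = 1.
Proof. by have [_ h] := set_mem (valP W); exact: h. Qed.

Definition comp_fun (X Y Z : finType) (V : channel Y Z) (W : channel X Y) :
    {ptws X * Z -> R} :=
  fun xz => \sum_(y : Y) prob V y xz.2 * prob W xz.1 y.

Lemma comp_funP (X Y Z : finType) (V : channel Y Z) (W : channel X Y) :
  comp_fun V W \in @is_channel X Z.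
Proof.
have sum1 x : \sum_(z : Z) comp_fun V W (x, z) = 1.
  rewrite /comp_fun exchange_big /= -(prob_sum1 W x).
  by apply: eq_bigr => y _; rewrite -mulr_suml prob_sum1 mul1r.
have ge0 x z : 0 <= comp_fun V W (x, z).
  apply: sumr_ge0 => y _; rewrite mulr_ge0 //.
    by case/andP: (prob_bounds V y z).
  by case/andP: (prob_bounds W x y).
apply/mem_set; split => // x z; rewrite ge0 /= -(sum1 x) (bigD1 z) //= lerDl.
by apply: sumr_ge0 => z' _; exact: ge0.
Qed.

Definition comp_channel (X Y Z : finType) (V : channel Y Z) (W : channel X Y) :
  channel X Z := exist _ (comp_fun V W) (comp_funP V W).

Definition degraded (X Y Z : finType) (W' : channel X Z) (W : channel X Y) :
  Prop := exists V : channel Y Z, W' = comp_channel V W.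

Definition equivalent (X Y Z : finType) (W : channel X Y) (W' : channel X Z) :
  Prop := degraded W W' /\ degraded W' W.

Lemma channel_ext (X Y : finType) (W W' : channel X Y) :
  (forall x y, prob W x y = prob W' x y) -> W = W'.
Proof. by move=> h; apply: val_inj; apply/funext => -[x y]; exact: h. Qed.

Definition id_fun (Y : finType) : {ptws Y * Y -> R} :=
  fun yz => (yz.1 == yz.2)%:R.

Lemma id_funP (Y : finType) : @id_fun Y \in @is_channel Y Y.
Proof.
apply/mem_set; split=> [x y|x]; rewrite /id_fun /=.
  by case: eqP; rewrite ?lexx ?ler01.
by rewrite (bigD1 x) //= eqxx big1 ?addr0 // => y; rewrite eq_sym => /negbTE->.
Qed.

Definition id_channel (Y : finType) : channel Y Y :=
  exist _ (@id_fun Y) (id_funP Y).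

Lemma degraded_refl (X Y : finType) (W : channel X Y) : degraded W W.
Proof.
exists (id_channel Y); apply: channel_ext => x z.
rewrite [RHS](_ : _ = \sum_(y : Y) (y == z)%:R * prob W x y) //.
rewrite (bigD1 z) //= eqxx mul1r big1 ?addr0 // => y /negbTE->.
by rewrite mul0r.
Qed.

Lemma degraded_trans (X Y1 Y2 Y3 : finType) (W1 : channel X Y1)
    (W2 : channel X Y2) (W3 : channel X Y3) :
  degraded W1 W2 -> degraded W2 W3 -> degraded W1 W3.
Proof.
move=> [V ->] [U ->]; exists (comp_channel V U); apply: channel_ext => x z.
transitivity (\sum_(y2 : Y2)
    prob V y2 z * \sum_(y3 : Y3) prob U y3 y2 * prob W3 x y3) => //.
transitivity (\sum_(y3 : Y3)
    (\sum_(y2 : Y2) prob V y2 z * prob U y3 y2) * prob W3 x y3) => //.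
under eq_bigr do rewrite mulr_sumr.
rewrite exchange_big /=; apply: eq_bigr => y3 _.
by rewrite mulr_suml; apply: eq_bigr => y2 _; rewrite mulrA.
Qed.

Lemma equivalent_refl (X Y : finType) (W : channel X Y) : equivalent W W.
Proof. by split; exact: degraded_refl. Qed.

Lemma equivalent_sym (X Y Z : finType) (W : channel X Y) (W' : channel X Z) :
  equivalent W W' -> equivalent W' W.
Proof. by case. Qed.

Lemma equivalent_trans (X Y1 Y2 Y3 : finType) (W1 : channel X Y1)
    (W2 : channel X Y2) (W3 : channel X Y3) :
  equivalent W1 W2 -> equivalent W2 W3 -> equivalent W1 W3.
Proof.
move=> [h12 h21] [h23 h32]; split; first exact: degraded_trans h12 h23.
exact: degraded_trans h32 h21.
Qed.

Definition channel_eqv (X Y : finType) : rel (channel X Y) :=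
  fun W W' => `[< equivalent W W' >].

Lemma channel_eqv_equiv (X Y : finType) : equiv_class_of (@channel_eqv X Y).
Proof.
split=> [W|W W'|W2 W1 W3]; first by apply/asboolP; exact: equivalent_refl.
  by apply/asboolP/asboolP; exact: equivalent_sym.
move=> /asboolP h12 /asboolP h23; apply/asboolP; exact: equivalent_trans h12 h23.
Qed.

Canonical channel_equiv_rel (X Y : finType) :=
  EquivRelPack (channel_eqv_equiv X Y).

Definition DMCo (X Y : finType) : topologicalType :=
  quotient_topology {eq_quot (channel_equiv_rel X Y)}.

(* The coproduct over the nonempty alphabets [n], n >= 1: the index [n] here
   stands for the alphabet with n + 1 letters. *)
Definition channel_star (X : finType) : choiceType :=
  {n : nat & channel X 'I_n.+1}.

Definition channel_star_eqv (X : finType) : rel (channel_star X) :=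
  fun W W' => `[< equivalent (tagged W) (tagged W') >].

Lemma channel_star_eqv_equiv (X : finType) :
  equiv_class_of (@channel_star_eqv X).
Proof.
split=> [W|W W'|W2 W1 W3]; first by apply/asboolP; exact: equivalent_refl.
  by apply/asboolP/asboolP; exact: equivalent_sym.
move=> /asboolP h12 /asboolP h23; apply/asboolP; exact: equivalent_trans h12 h23.
Qed.

Canonical channel_star_equiv_rel (X : finType) :=
  EquivRelPack (channel_star_eqv_equiv X).

Definition DMCo_star (X : finType) : choiceType :=
  {eq_quot (channel_star_equiv_rel X)}.

Definition class_star (X : finType) (n : nat) (W : channel X 'I_n.+1) :
    DMCo_star X :=
  \pi_({eq_quot (channel_star_equiv_rel X)})
    (existT (fun n => channel X 'I_n.+1) n W).

(* The identification of the space of classes of channels with output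
   alphabet ['I_n.+1] with a subset of [DMCo_star X]. *)
Definition embed (X : finType) (n : nat) (q : DMCo X 'I_n.+1) : DMCo_star X :=
  class_star (repr (q : {eq_quot (channel_equiv_rel X 'I_n.+1)})).

Lemma class_starP (X : finType) (n m : nat) (W : channel X 'I_n.+1)
    (W' : channel X 'I_m.+1) :
  class_star W = class_star W' <-> equivalent W W'.
Proof.
have P := @eqmodP _ (channel_star_equiv_rel X)
  (existT (fun n => channel X 'I_n.+1) n W)
  (existT (fun n => channel X 'I_n.+1) m W').
by split=> [/P /asboolP|h]; last exact/P/asboolP.
Qed.

Lemma embed_pi (X : finType) (n : nat) (W : channel X 'I_n.+1) :
  embed (\pi_({eq_quot (channel_equiv_rel X 'I_n.+1)}) W : DMCo X 'I_n.+1) =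
  class_star W.
Proof.
apply/class_starP/asboolP.
exact/(@eqmodP _ (channel_equiv_rel X 'I_n.+1))/reprK.
Qed.

Lemma embed_inj (X : finType) (n : nat) : injective (@embed X n).
Proof.
move=> p q /class_starP h.
rewrite -[p]reprK -[q]reprK.
exact/(@eqmodP _ (channel_equiv_rel X 'I_n.+1))/asboolP.
Qed.

Lemma range_embed (X : finType) (n : nat) :
  range (@embed X n) =
  [set q | exists W : channel X 'I_n.+1, q = class_star W].
Proof.
apply/seteqP; split=> [_ [q _ <-]|_ [W ->]]; first by exists (repr q).
by eexists; last exact: embed_pi.
Qed.

End Channels.

(* A topology on a set [T], as a library topological structure with carrier
   [T].  (Besides the open sets, the structure bundles a choice operator and a
   neighbourhood filter determined by the open sets.) *)
Definition topology_on (T : Type) := Topological.axioms_ T.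

Definition tau_open (T : Type) (tau : topology_on T) : set (set T) :=
  @open (Topological.Pack tau).

(* By [embed_inj] and [range_embed], the family on the right is the subspace
   topology on the set of classes containing a channel with output alphabet
   ['I_n.+1], transported along the identification [embed]. *)
Definition natural (R : realType) (X : finType)
    (tau : topology_on (DMCo_star R X)) : Prop :=
  forall n : nat,
    (@open (DMCo R X 'I_n.+1) : set (set (DMCo R X 'I_n.+1))) =
    [set @embed R X n @^-1` U | U in tau_open tau].

Definition metric_on (R : realType) (T : Type) := Metric.axioms_ R T.

Definition complete_metric (R : realType) (T : Type) (m : metric_on R T) :
    Prop :=
  let M : metricType R := Metric.Pack m in
  forall u : nat -> M,
    cauchy (u @ \oo) -> exists l : M, u @ \oo --> l.

Definition completely_metrizable (R : realType) (T : Type)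
    (tau : topology_on T) : Prop :=
  exists m : metric_on R T,
    complete_metric m /\
    tau_open tau = @open (Metric.Pack m : metricType R).

(* Main.v *)
(* By Baire, it suffices to see that the subsets of classes of channels with n
   outputs are closed with empty interior.  They are closed because they are
   compact.  For the interior, fix two inputs x0, x1 and consider, for a channel
   W, the function t |-> \sum_y |t W(y|x0) - W(y|x1)|.  By the triangle
   inequality it decreases under degradation, so it only depends on the class
   of W; its kinks are the likelihood ratios W(y|x1) / W(y|x0), so there are at
   most n of them when W has n outputs.  Padding W with n + 1 outputs of
   probability 0 and mixing in a little of a channel with pairwise distinct
   ratios gives channels close to W with more than n kinks. *)

Require Import Defs.
From mathcomp Require Import all_boot all_order all_algebra.
From mathcomp Require Import all_classical all_reals all_analysis.
From mathcomp Require Import ring lra.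

Set Implicit Arguments.
Unset Strict Implicit.
Unset Printing Implicit Defensive.

Import Order.TTheory GRing.Theory Num.Theory.
Import numFieldNormedType.Exports.

Local Open Scope classical_set_scope.
Local Open Scope ring_scope.

(** * Kinks of the gain as an invariant of equivalence *)

Lemma normr_convex (R : realDomainType) (a b : R) :
  `|a| *+ 2 <= `|a + b| + `|a - b|.
Proof.
rewrite -normrMn mulr2n; have -> : a + a = (a + b) + (a - b) by ring.
exact: ler_normD.
Qed.

Lemma normr_affine (R : realDomainType) (a b : R) :
  `|b| <= `|a| -> `|a + b| + `|a - b| = `|a| *+ 2.
Proof.
move=> ba.
have [a0|a0] := leP 0 a; move: ba.
  rewrite (ger0_norm a0) ler_norml => /andP[b1 b2].
  by rewrite !ger0_norm ?mulr2n; lra.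
rewrite (ltr0_norm a0) ler_norml => /andP[b1 b2].
by rewrite !ler0_norm ?mulr2n; lra.
Qed.

Section Gain.
Variables (R : realType) (X : finType) (x0 x1 : X).

Definition gain (Y : finType) (W : channel R X Y) (t : R) : R :=
  \sum_(y : Y) `|t * prob W x0 y - prob W x1 y|.

Lemma degraded_gain (Y Z : finType) (W : channel R X Y) (W' : channel R X Z)
    (t : R) : degraded W' W -> gain W' t <= gain W t.
Proof.
move=> [V ->].
(* The rows of [V] sum to 1, so each term can be spread over the outputs [z]. *)
have -> : gain W t =
    \sum_(y : Y) \sum_(z : Z) prob V y z * `|t * prob W x0 y - prob W x1 y|.
  by apply: eq_bigr => y _; rewrite -mulr_suml prob_sum1 mul1r.
rewrite exchange_big; apply: ler_sum => z _.
have -> : t * prob (comp_channel V W) x0 z - prob (comp_channel V W) x1 z =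
    \sum_(y : Y) prob V y z * (t * prob W x0 y - prob W x1 y).
  rewrite {1 2}/prob /= /comp_fun /= mulr_sumr -sumrB.
  by apply: eq_bigr => y _; ring.
apply: le_trans (ler_norm_sum _ _ _) _; apply: ler_sum => y _.
by rewrite normrM ger0_norm //; case/andP: (prob_bounds V y z).
Qed.

Lemma equivalent_gain (Y Z : finType) (W : channel R X Y) (W' : channel R X Z)
    (t : R) : equivalent W W' -> gain W t = gain W' t.
Proof.
by move=> [h h']; apply/eqP; rewrite eq_le !degraded_gain.
Qed.

(** The likelihood ratio of [y], cleared of its denominator; positivity makes [t] unique. *)
Definition has_ratio (Y : finType) (W : channel R X Y) (t : R) (y : Y) : Prop :=
  0 < prob W x0 y /\ t * prob W x0 y = prob W x1 y.

(** All summands are convex in [t]; that of [y] is zero at [t] and positive on both sides, hence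
    strictness. *)
Lemma gain_kink (Y : finType) (W : channel R X Y) (t h : R) (y : Y) :
  has_ratio W t y -> 0 < h ->
  gain W t *+ 2 < gain W (t + h) + gain W (t - h).
Proof.
move=> [p0 tp] h0; rewrite -big_split -sumrMnl /=.
rewrite (bigD1 y) //= [ltRHS](bigD1 y) //=; apply: ltr_leD.
  rewrite mulrDl mulrBl tp addrAC [X in _ + `|X|]addrAC !subrr normr0 mul0rn.
  by rewrite addr_gt0 ?normr_gt0 // ?add0r ?oppr_eq0 mulf_neq0 ?gt_eqF.
apply: ler_sum => z _; rewrite mulrDl mulrBl.
by rewrite addrAC [X in _ + `|X|]addrAC; exact: normr_convex.
Qed.

(** Summands with [prob W x0 y = 0] are constant in [t]; the others do not vanish at [t], so they
    are affine nearby. *)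
Lemma gain_affine (Y : finType) (W : channel R X Y) (t : R) :
  (forall y, ~ has_ratio W t y) ->
  exists2 h, 0 < h & gain W (t + h) + gain W (t - h) = gain W t *+ 2.
Proof.
move=> nr.
pose d y := `|t * prob W x0 y - prob W x1 y|.
(* As [prob W x0 y <= 1], a step [h <= d y] cannot carry the summand past its zero. Any positive
   start would do instead of 1. *)
pose h := \big[Num.min/1]_(y : Y | 0 < prob W x0 y) d y.
have h0 : 0 < h.
  apply/bigmin_gtP; split=> // y py; rewrite normr_gt0 subr_eq0.
  by apply/eqP => tp; exact: (nr y).
exists h => //; rewrite -big_split -sumrMnl /=; apply: eq_bigr => y _.
rewrite mulrDl mulrBl addrAC [X in _ + `|X|]addrAC normr_affine //.
have /andP[p0 p1] := prob_bounds W x0 y.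
have [py|py] := ltP 0 (prob W x0 y); last first.
  have -> : prob W x0 y = 0 by apply/eqP; rewrite eq_le py.
  by rewrite mulr0 normr0.
rewrite ger0_norm ?mulr_ge0 ?(ltW h0) //.
apply: (@le_trans _ _ h); first by rewrite ler_piMr // ltW.
exact: bigmin_le_cond.
Qed.

Lemma equivalent_has_ratio (Y Z : finType) (W : channel R X Y)
    (W' : channel R X Z) (t : R) (y : Y) :
  equivalent W W' -> has_ratio W t y -> exists z, has_ratio W' t z.
Proof.
move=> eqW ry; apply: contrapT => /forallNP /gain_affine[h h0].
rewrite -!(equivalent_gain _ eqW) => eqg.
by have := gain_kink ry h0; rewrite eqg ltxx.
Qed.

(** Pigeonhole: equivalence transfers every ratio [t i] to some output of [W'], and one output
    carries at most one ratio. *)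
Lemma not_equivalent_ratios (I Y Z : finType) (W : channel R X Y)
    (W' : channel R X Z) (t : I -> R) (y : I -> Y) :
  injective t -> (forall i, has_ratio W (t i) (y i)) -> (#|Z| < #|I|)%N ->
  ~ equivalent W W'.
Proof.
move=> t_inj rW ltZI eqW.
have /choice[z rz] i : exists z, has_ratio W' (t i) z.
  exact: equivalent_has_ratio eqW (rW i).
suff /leq_card : injective z by rewrite leqNgt ltZI.
move=> i j zij; apply: t_inj.
have [p0 ti] := rz i; have [_ tj] := rz j.
by apply: (mulIf (lt0r_neq0 p0)); rewrite ti zij tj.
Qed.

End Gain.

(** * Relabellings, mixtures and a channel with distinct ratios *)

Section Constructions.
Variable R : realType.

Definition mk_channel (X Y : finType) (w : {ptws X * Y -> R})
    (wP : is_channel w) : channel R X Y := exist _ w (mem_set wP).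

Lemma prob_mk (X Y : finType) (w : {ptws X * Y -> R}) (wP : is_channel w) x y :
  prob (mk_channel wP) x y = w (x, y).
Proof. by []. Qed.

Lemma deterministic_funP (Y Z : finType) (f : Y -> Z) :
  is_channel ((fun yz => (f yz.1 == yz.2)%:R) : {ptws Y * Z -> R}).
Proof.
split=> [y z|y] /=; first by case: eqP; rewrite ?lexx ?ler01.
rewrite (bigD1 (f y)) //= eqxx big1 ?addr0 // => z.
by rewrite eq_sym => /negbTE ->.
Qed.

Definition deterministic (Y Z : finType) (f : Y -> Z) : channel R Y Z :=
  mk_channel (deterministic_funP f).

Lemma prob_relabel (X Y Z : finType) (f : Y -> Z) (W : channel R X Y) x z :
  prob (comp_channel (deterministic f) W) x z =
  \sum_(y | f y == z) prob W x y.
Proof.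
rewrite [RHS]big_mkcond; apply: eq_bigr => y _ /=.
by rewrite prob_mk /=; case: eqP; rewrite ?mul1r ?mul0r.
Qed.

Lemma relabel_equivalent (X Y Z : finType) (f : Y -> Z) (g : Z -> Y)
    (W : channel R X Y) :
  cancel f g -> equivalent (comp_channel (deterministic f) W) W.
Proof.
move=> fK; split; first by exists (deterministic f).
exists (deterministic g); apply: channel_ext => x y.
rewrite prob_relabel; under eq_bigr do rewrite prob_relabel.
(* Only [y] itself contributes, through the single intermediate output [f y]. *)
rewrite (exchange_big_dep predT) //= (bigD1 y) //= (big_pred1 (f y)).
  rewrite big1 ?addr0 // => y' ne; apply: big_pred0 => z.
  by apply: contra_neqF ne => /andP[/eqP <- /eqP <-]; rewrite fK.
by move=> z /=; rewrite eq_sym andb_idl // => /eqP <-; rewrite fK.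
Qed.

Lemma mix_funP (X Y : finType) (W U : channel R X Y) (s : R) : 0 <= s <= 1 ->
  is_channel ((fun xy => (1 - s) * prob W xy.1 xy.2 + s * prob U xy.1 xy.2)
    : {ptws X * Y -> R}).
Proof.
move=> /andP[s0 s1]; split=> [x y|x] /=.
  have /andP[W0 W1] := prob_bounds W x y.
  have /andP[U0 U1] := prob_bounds U x y.
  by apply/andP; split; nra.
by rewrite big_split /= -!mulr_sumr !prob_sum1; ring.
Qed.

Definition mix (X Y : finType) (W U : channel R X Y) (s : R)
    (s01 : 0 <= s <= 1) : channel R X Y := mk_channel (mix_funP W U s01).

Lemma exists_distinct_ratios (X : finType) (x0 x1 : X) (m : nat) : x0 != x1 ->
  exists U : channel R X 'I_m.+1, (forall z, 0 < prob U x0 z) /\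
    injective (fun z => prob U x1 z / prob U x0 z).
Proof.
move=> ne01.
(* Row [x1] has weights 1, ..., m+1 and the other rows are constant: after normalization the ratio
   at [z] is z+1 up to a common factor. *)
pose w (xz : X * 'I_m.+1) : R := if xz.1 == x1 then xz.2.+1%:R else 1.
have w0 x z : 0 < w (x, z) by rewrite /w; case: ifP.
pose S x := \sum_z w (x, z).
have wS x z : w (x, z) <= S x.
  by rewrite /S (bigD1 z) //= lerDl sumr_ge0 // => i _; exact: ltW.
have S0 x : 0 < S x by exact: lt_le_trans (w0 x ord0) (wS _ _).
have UP : is_channel ((fun xz => w xz / S xz.1) : {ptws X * 'I_m.+1 -> R}).
  split=> [x z|x] /=.
    by rewrite ler_pdivrMr ?mul1r // wS andbT; apply: divr_ge0; rewrite ltW.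
  by rewrite -mulr_suml mulfV //; exact/lt0r_neq0/S0.
exists (mk_channel UP); split=> [z|y z].
  by rewrite prob_mk; exact: divr_gt0 (w0 _ _) (S0 _).
rewrite !prob_mk /= /w /= eqxx (negbTE ne01).
move/mulIf => /(_ _)/mulIf eqyz; apply/val_inj.
suff /eqP : (y.+1%:R = z.+1%:R :> R) by rewrite eqr_nat => /eqP[].
by apply: eqyz; rewrite ?invr_neq0 ?mulf_neq0 ?oner_neq0 ?gt_eqF ?invr_gt0.
Qed.

End Constructions.

(** * Convergence, compactness and the Baire property *)

Lemma cvg_pointwise (T I : Type) (V : topologicalType) (F : set_system T)
    (FF : Filter F) (u : T -> {ptws I -> V}) (f : {ptws I -> V}) :
  (forall i, u t i @[t --> F] --> f i) -> u @ F --> f.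
Proof.
move=> uf; apply/cvg_sup => i A [B [[D oD <-] Df] sBA].
apply: filterS sBA _; apply: (uf i); exact: open_nbhs_nbhs.
Qed.

Lemma cvg_set_type (T : Type) (V : topologicalType) (A : set V)
    (F : set_system T) (FF : Filter F) (u : T -> set_type A) (a : set_type A) :
  (fun t => set_val (u t)) @ F --> set_val a -> u @ F --> a.
Proof.
move=> ua B [D [[E oE <-] Ea] sDB].
apply: filterS sDB _; apply: ua; exact: open_nbhs_nbhs.
Qed.

Lemma range_set_type_compact (V T : topologicalType) (A : set V)
    (f : set_type A -> T) : compact A -> continuous f -> compact (range f).
Proof.
move=> cA cf; have [-> |/set0P[_ [a _ _]]] := eqVneq (range f) set0.
  exact: compact0.
(* [f] is extended to [V] by the dummy value [f a], since [cA] concerns a subset of [V]. *)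
pose g : V -> T := valL_ (f a) f.
have cg : {within A, continuous g} by exact/subspace_valL_continuousP'.
suff -> : range f = g @` A by exact: continuous_compact cg cA.
have gE (v : set_type A) : g (set_val v) = f v.
  by have /(congr1 (@^~ v)) := valLK (f a) f.
apply/seteqP; split=> _ [v Av <-].
  by exists (set_val v); [exact: set_valP|exact: gE].
by exists (exist _ v (mem_set Av)) => //; rewrite -gE.
Qed.

(** Row sums cut out a closed subset of a cube, which is compact by Tychonoff. *)
Lemma is_channel_compact (R : realType) (X Y : finType) :
  compact (@is_channel R X Y).
Proof.
pose C : set {ptws X * Y -> R} := [set W | forall i, `[0, 1]%classic (W i)].
have cC : compact C.
  exact: (@tychonoff _ (fun=> R) _ (fun=> @segment_compact R 0 1)).
pose S x : set {ptws X * Y -> R} := [set W | \sum_(y : Y) W (x, y) = 1].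
have -> : @is_channel R X Y = C `&` \bigcap_x S x.
  apply/seteqP; split=> W [W01 WS]; split=> //.
  - by move=> [x y]; rewrite /= in_itv /=; exact: W01.
  - by move=> x _; exact: WS.
  - by move=> x y; have := W01 (x, y); rewrite /= in_itv.
  - by move=> x; exact: WS.
apply: compact_closedI => //.
apply: closed_bigI => x _.
apply: (@preimage_closed _ _ (fun W : {ptws X * Y -> R} => \sum_y W (x, y))
  [set 1]); last exact: closed_eq.
apply: in1W; apply: continuous_big => [|y _]; first exact: add_continuous.
exact: (@proj_continuous _ (fun=> R)).
Qed.

(** If no [F n] had interior, shrinking balls could avoid them one after another, and the limit of
    the centers would lie in none. *)
Lemma complete_baire (R : realType) (M : metricType R) (F : nat -> set M) :
  (forall u : nat -> M, cauchy (u @ \oo) -> exists l : M, u @ \oo --> l) ->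
  M -> (forall n, closed (F n)) -> (forall x, exists n, F n x) ->
  exists n (x : M), nbhs x (F n).
Proof.
move=> cM x0 cF covF; apply: contrapT => nF.
(* The radius is doubled so that limits of centers, which a priori only lie in
   closed balls, stay in the open ones. *)
have step (s : nat * (M * {posnum R})) : exists t : M * {posnum R},
    [/\ ball t.1 (2 * t.2%:num) `<=` ball s.2.1 s.2.2%:num,
        ball t.1 (2 * t.2%:num) `<=` ~` F s.1 & t.2%:num <= s.1.+1%:R^-1].
  case: s => n [x r] /=.
  have [y [xy nFy]] : exists y, ball x (r%:num / 2) y /\ ~ F n y.
    apply: contrapT => /forallNP h; apply: nF; exists n, x.
    apply/nbhs_ballP; exists (r%:num / 2) => //= y xy.
    by apply: contrapT => nFy; exact: (h y).
  have /nbhs_ballP[e /= e0 eF] : nbhs y (~` F n).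
    by apply: open_nbhs_nbhs; split=> //; exact: closed_openC.
  (* Doubled, r/4 fits in the r/2 left around [y] and e/2 stays off [F n]; the last bound sends the
     radii to 0. *)
  have d0 : 0 < Num.min (Num.min (r%:num / 4) (e / 2)) n.+1%:R^-1.
    by rewrite !lt_min !divr_gt0 //=.
  exists (y, PosNum d0) => /=.
  set d := Num.min _ _.
  have [dr de dn] : [/\ d <= r%:num / 4, d <= e / 2 & d <= n.+1%:R^-1].
    by rewrite /d !ge_min !lexx !orbT.
  split=> // [z yz|].
    have -> : r%:num = r%:num / 2 + r%:num / 2 by field.
    by apply: ball_triangle xy _; apply: le_ball yz; lra.
  by apply: subset_trans eF; apply: le_ball; lra.
have [f fP] := choice step.
(* The ball avoiding [F n] is [s n.+1], hence the shifted indices below. *)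
pose fix s n := if n is k.+1 then f (k, s k) else (x0, PosNum ltr01).
have shrink n k : ball (s (n + k)%N).1 (2 * (s (n + k)%N).2%:num)
    `<=` ball (s n).1 (2 * (s n).2%:num).
  elim: k => [|k IH]; first by rewrite addn0.
  rewrite addnS /=; have [h _ _] := fP ((n + k)%N, s (n + k)%N).
  apply: subset_trans h _ => /=; apply: subset_trans IH; apply: le_ball.
  by rewrite ler_peMl ?ler1n.
have inball n k : (n <= k)%N -> ball (s n.+1).1 (2 * (s n.+1).2%:num) (s k.+1).1.
  move=> nk; rewrite -(subnKC nk) -addSn; apply: (shrink n.+1); exact: ballxx.
have inball1 n k : (n < k)%N -> ball (s n.+1).1 (s n.+1).2%:num (s k.+1).1.
  move=> nk; have [h _ _] := fP (n.+1, s n.+1); apply: h.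
  by rewrite -/(s n.+2); exact: inball.
pose u n := (s n.+1).1.
have [l ul] : exists l : M, u @ \oo --> l.
  apply: cM; apply: cauchy_exP => e e0.
  have [n ne] : exists n, n.+1%:R^-1 < e.
    have [n _ /(_ n (leqnn n)) h] := near_infty_natSinv_lt (PosNum e0).
    by exists n.
  exists (u n); exists n.+1 => // k /= nk.
  have [_ _ le] := fP (n, s n).
  by apply: le_ball (inball1 _ _ nk); apply: le_trans le (ltW ne).
have [n Fnl] := covF l.
have [_ nFn _] := fP (n, s n); apply: (nFn l) Fnl => /=.
have /= d0 : 0 < (s n.+1).2%:num by [].
have /ul [m _ hm] : nbhs l (ball l (s n.+1).2%:num) by exact: nbhsx_ballx.
rewrite -/(s n.+1) mulr_natl mulr2n.
(* A late center is within one radius of both [l] and the center of [s n.+1], so [l] is in the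
   doubled ball. *)
apply: (@ball_triangle _ _ (u (maxn m n.+1))).
  by apply: inball1; rewrite leq_max leqnn orbT.
by apply: ball_sym; apply: (hm (maxn m n.+1)) => /=; rewrite leq_max leqnn.
Qed.

(** * Perturbations with too many kinks *)

Section Perturbation.
Variables (R : realType) (X : finType).

Lemma cvg_mix (Y : finType) (W U : channel R X Y) (s : nat -> R)
    (s01 : forall k, 0 <= s k <= 1) :
  s @ \oo --> 0 -> (fun k => mix W U (s01 k)) @ \oo --> W.
Proof.
move=> s0; apply: cvg_set_type; apply: cvg_pointwise => -[x y].
rewrite [X in _ --> X](_ : _ = (1 - 0) * prob W x y + 0 * prob U x y).
  apply: cvgD; last by apply: cvgMr_tmp.
  by apply: cvgMr_tmp; apply: cvgB => //; exact: cvg_cst.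
by rewrite subr0 mul1r mul0r addr0 /prob set_valE.
Qed.

Lemma exists_perturbation (n : nat) (W : channel R X 'I_n.+1) :
  (2 <= #|X|)%N ->
  exists m (W' : channel R X 'I_m.+1) (u : nat -> channel R X 'I_m.+1),
    [/\ equivalent W' W, u @ \oo --> W' &
      forall k (V : channel R X 'I_n.+1), ~ equivalent (u k) V].
Proof.
case/card_gt1P => x0 [x1 [_ _ ne01]].
(* This index means n.+1 + n.+2 letters: the new outputs alone outnumber those of [V] by one. *)
exists (n + n.+2)%N.
pose f : 'I_n.+1 -> 'I_(n.+1 + n.+2) := @lshift n.+1 n.+2.
(* A left inverse of the padding [f]; its value [ord0] on new outputs is arbitrary. *)
pose g (z : 'I_(n.+1 + n.+2)) : 'I_n.+1 :=
  if fintype.split z is inl y then y else ord0.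
have fK : cancel f g by move=> y; rewrite /g (unsplitK (inl y)).
pose W' := comp_channel (deterministic R f) W.
have [U [U0 U_inj]] := exists_distinct_ratios R (n + n.+2) ne01.
have s01 k : 0 <= (k.+1%:R^-1 : R) <= 1.
  by rewrite invr_ge0 ler0n invf_le1 ?ltr0n ?ler1n.
exists W', (fun k => mix W' U (s01 k)); split.
- exact: relabel_equivalent fK.
- apply: cvg_mix; exact: cvg_harmonic.
move=> k V.
(* W' vanishes on the outputs [y i], so there the mixture has the ratios of U. *)
pose y (i : 'I_n.+2) : 'I_(n.+1 + n.+2) := rshift n.+1 i.
have W'0 x i : prob W' x (y i) = 0.
  by rewrite prob_relabel big_pred0 // => j; rewrite /f /y eq_lrshift.
apply: (@not_equivalent_ratios R X x0 x1 'I_n.+2 _ _ _ _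
  (fun i => prob U x1 (y i) / prob U x0 (y i)) y).
- by move=> i j /U_inj; exact: (@rshift_inj n.+1 n.+2).
- move=> i; rewrite /has_ratio !prob_mk /= !W'0 !mulr0 !add0r.
  have Ui := U0 (y i); split; first by rewrite mulr_gt0 // invr_gt0 ltr0n.
  by rewrite mulrCA divfK // gt_eqF.
by rewrite !card_ord.
Qed.

End Perturbation.

(** * Natural topologies and the Baire argument *)

Lemma class_star_continuous (R : realType) (X : finType)
    (m : metric_on R (DMCo_star R X)) (M := Metric.Pack m : metricType R)
    (n : nat) :
  (@open (DMCo R X 'I_n.+1) : set (set (DMCo R X 'I_n.+1))) =
    [set @embed R X n @^-1` U | U in @open M] ->
  continuous (@class_star R X n : channel R X 'I_n.+1 -> M).
Proof.
move=> openE; apply/continuousP => U oU.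
have : open (@embed R X n @^-1` U : set (DMCo R X 'I_n.+1)).
  by rewrite openE; exists U.
(* [class_star] is the projection followed by [embed], and quotient openness is tested on preimages
   under the projection. *)
rewrite {1}/open /= /quotient_open.
congr (open _); apply/seteqP.
by split=> W /=; rewrite embed_pi.
Qed.

Theorem corollary7 (R : realType) (X : finType) (hX : (2 <= #|X|)%N)
    (tau : topology_on (DMCo_star R X)) :
  natural tau -> ~ completely_metrizable R tau.
Proof.
move=> nat_tau [m [cm tauE]].
pose M : metricType R := Metric.Pack m.
have cs n : continuous (@class_star R X n : channel R X 'I_n.+1 -> M).
  by apply: class_star_continuous; rewrite nat_tau tauE.
pose F n : set M := range (@class_star R X n).
have cF n : closed (F n).
  apply: compact_closed; first exact: metric_hausdorff.
  exact: range_set_type_compact (@is_channel_compact R X _) (cs n).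
have covF (q : M) : exists n, F n q.
  exists (tag (repr q)), (tagged (repr q)) => //.
  by rewrite /class_star; case: (repr q) (reprK q).
have [x0 [x1 [_ _ ne01]]] := card_gt1P hX.
have [U0 _] := exists_distinct_ratios R 0 ne01.
have [n [q nbhsq]] := complete_baire cm (class_star U0) cF covF.
have [W _ Wq] := nbhs_singleton nbhsq; move: nbhsq; rewrite -Wq => nbhsW.
have [k [W' [u [eqW cu nu]]]] := exists_perturbation W hX.
(* [W] and [W'] share their class, so the neighbourhood can be pulled back to the larger alphabet,
   where it catches some [u N]. *)
have : nbhs (class_star W' : M) (F n).
  by have /class_starP -> := eqW.
move=> /(cs k W')/cu [N _ /(_ N (leqnn N))[V _ /class_starP]].
by move=> /equivalent_sym; exact: nu.
Qed.
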